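(* Let $n$ and $N$ be positive integers. If $n+1<N<2n$, then there is no $N$-point universally optimal configuration on $S^{n-1}$.
   Context: $S^{n-1}$ is the unit sphere in $\mathbb{R}^n$. A $C^\infty$ function $f\colon(0,4]\to\mathbb{R}$ is completely monotonic if $(-1)^kf^{(k)}(x)\ge0$ for all $x\in(0,4]$ and $k\ge0$. The $f$-potential energy of a finite subset $\mathcal{C}\subset S^{n-1}$ is $\sum_{x,y\in\mathcal{C},\,x\neq y}f(|x-y|^2)$. A finite subset $\mathcal{C}\subset S^{n-1}$ is universally optimal if it (weakly) minimizes $f$-potential energy among all configurations of $|\mathcal{C}|$ points on $S^{n-1}$, for each completely monotonic potential function $f\colon(0,4]\to\mathbb{R}$. *)

(* Defs.v *)
From mathcomp Require Import all_boot all_order all_algebra finmap.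
From mathcomp Require Import all_classical all_reals all_analysis.

Set Implicit Arguments.
Unset Strict Implicit.
Unset Printing Implicit Defensive.

Import Order.TTheory GRing.Theory Num.Theory.
Import numFieldNormedType.Exports.

Local Open Scope classical_set_scope.
Local Open Scope ring_scope.

(* The norm `|x| that the library puts on 'rV[R]_n is the sup norm. *)
Definition enorm (R : realType) (n : nat) (x : 'rV[R]_n) : R :=
  Num.sqrt (\sum_(i < n) x ord0 i ^+ 2).

(* sphere R n is S^(n-1), inside R^n. *)
Definition sphere (R : realType) (n : nat) : set 'rV[R]_n :=
  [set x | enorm x = 1].

(* Differentiation relative to a set A: the difference quotient at x is only
   sampled at points of A, so that derivatives at an endpoint belonging to A
   are one-sided and the values of f outside A are irrelevant. *)
Definition difference_quotient (R : realType) (f : R -> R) (x y : R) : R :=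
  (f y - f x) / (y - x).

Definition derivable_within (R : realType) (A : set R) (f : R -> R) (x : R) :
    Prop :=
  cvg (difference_quotient f x y @[y --> within A x^']).

Definition derive_within (R : realType) (A : set R) (f : R -> R) (x : R) : R :=
  lim (difference_quotient f x y @[y --> within A x^']).

Definition derive_within_n (R : realType) (A : set R) (k : nat) (f : R -> R) :
    R -> R :=
  iter k (derive_within A) f.

Definition smooth_within (R : realType) (A : set R) (f : R -> R) : Prop :=
  forall (k : nat) (x : R), A x -> derivable_within A (derive_within_n A k f) x.

(* A function (0,4] -> R is represented by any extension of it to R. *)
Definition completely_monotonic (R : realType) (f : R -> R) : Prop :=
  smooth_within `]0, 4] f /\
  forall (k : nat) (x : R), 0 < x <= 4 ->
    0 <= (-1) ^+ k * derive_within_n `]0, 4] k f x.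

(* The sum ranges over ordered pairs of distinct points. *)
Definition potential_energy (R : realType) (n : nat) (f : R -> R)
    (C : {fset 'rV[R]_n}) : R :=
  \sum_(x <- C) \sum_(y <- C | x != y) f (enorm (x - y) ^+ 2).

Definition universally_optimal (R : realType) (n : nat)
    (C : {fset 'rV[R]_n}) : Prop :=
  [set` C] `<=` @sphere R n /\
  forall f : R -> R, completely_monotonic f ->
  forall C' : {fset 'rV[R]_n},
    [set` C'] `<=` @sphere R n -> #|` C'|%fset = #|` C|%fset ->
    potential_energy f C <= potential_energy f C'.

(* Main.v *)
Require Import Defs.
From mathcomp Require Import all_boot all_order all_algebra finmap.
From mathcomp Require Import all_classical all_reals all_analysis.
From mathcomp Require Import ring lra zify.

(** For the completely monotonic potentials f(r) = ((4 - r) / 2)^k, a pair of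
    unit vectors with inner product t contributes (1 + t)^k to the energy. As k
    grows, pairs with t > 0 blow up, pairs with t < 0 disappear and each
    orthogonal pair contributes exactly 1. So everything depends on the number
    of orthogonal pairs, counted by [contacts] as ordered pairs.

    Write N = 2p + d + 2 and n = p + d + 1; the assumptions on N say that
    p >= 1 and d >= 1.

    Upper bound. In the hyperplane orthogonal to a unit vector e (the apex),
    place N - 1 vectors with pairwise nonpositive inner products: p mutually
    orthogonal antipodal pairs and, orthogonally to them, the d + 1 vertices of
    an obtuse simplex in dimension d ([base]). Push all of them away from e by a
    depth s ([lowered]). Inner products with the apex become -s, while
    orthogonal pairs of the base only rise to s^2. With s = J^-2 and k = J^3 one
    has s k -> oo and s^2 k -> 0: in the limit the apex costs nothing and the
    orthogonal pairs of the base still cost 1 each ([lowered_energy_cvg]).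
    Hence a universally optimal configuration has nonpositive inner products
    and at most as many contacts as the base ([optimal_contacts]), which is at
    most 2p(2p + d - 1) + (d + 1)2p ([contacts_base]).

    Lower bound. Let x_1, ..., x_N have nonpositive inner products, and join i
    and j when x_i and x_j are not orthogonal. If v is a linear dependency then
    so is |v|, because passing to absolute values can only decrease the norm of
    the combination. Pairing the dependency |v| with x_j, where v_j = 0, gives a
    sum of terms of one sign, so v vanishes at the neighbours of j, and then on
    the whole connected component of j. A dependency is therefore determined by
    its values at one point of each component with at least two points, so that
    at least N - n = p + 1 components are of this kind ([corank_le_blocks]). As
    points of different components are orthogonal, this bounds the number of
    non-orthogonal pairs; the worst case is p pairs and one component of size
    d + 2, and the number of contacts is at least
    N(N - 1) - 2p - (d + 2)(d + 1) ([contacts_ge]).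

    The lower bound exceeds the upper one by 4p > 0. *)

Set Implicit Arguments.
Unset Strict Implicit.
Unset Printing Implicit Defensive.

Import Order.TTheory GRing.Theory Num.Theory.
Import numFieldNormedType.Exports.

Local Open Scope ring_scope.

(** * Powers of 4 - r are completely monotonic *)

Section PowerPotentials.
Local Open Scope classical_set_scope.
Variable R : realType.

Lemma within_dnbhs_proper (x : R) : 0 < x <= 4 ->
  ProperFilter (within `]0, 4]%classic (x^')).
Proof.
move=> /andP[x0 x4]; apply: Build_ProperFilter_ex => B.
rewrite /within /dnbhs /= => -[d /= d0 dB].
(* Points slightly to the left of x stay in the domain even when x = 4. *)
pose y := x - Num.min (d / 2) (x / 2).
have m0 : 0 < Num.min (d / 2) (x / 2) by rewrite lt_min; apply/andP; split; lra.
have md : Num.min (d / 2) (x / 2) <= d / 2 by rewrite ge_min lexx.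
have mx : Num.min (d / 2) (x / 2) <= x / 2 by rewrite ge_min lexx orbT.
exists y; apply: dB.
- rewrite /ball /= /y opprB addrC subrK gtr0_norm //; lra.
- by apply/eqP; rewrite /y; lra.
- rewrite in_itv /= /y; apply/andP; split; lra.
Qed.

Lemma cvg_finsum (I : finType) (P : pred I) (T : Type) (F : set_system T)
    {FF : Filter F} (f : I -> T -> R) (l : I -> R) :
  (forall i, P i -> f i x @[x --> F] --> l i) ->
  \sum_(i | P i) f i x @[x --> F] --> \sum_(i | P i) l i.
Proof.
exact: (@cvg_big R I +%R 0 P add_continuous T F (index_enum I) f l FF).
Qed.

(** The proof expands the quotient of (4 - y)^m - (4 - x)^m by y - x as a
    polynomial in y, so one continuity argument covers both the interior points
    and the endpoint 4. *)
Lemma difference_quotient_cvg (c : R) (m : nat) (g : R -> R) (x : R) :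
  0 < x <= 4 ->
  (forall y, 0 < y <= 4 -> g y = c * (4 - y) ^+ m) ->
  difference_quotient g x y @[y --> within `]0, 4]%classic x^'] -->
    - (c * m%:R * (4 - x) ^+ m.-1).
Proof.
move=> xA gE.
pose q (y : R) := - (c * \sum_(i < m) (4 - y) ^+ (m.-1 - i) * (4 - x) ^+ i).
have qE : \forall y \near within `]0, 4]%classic x^',
    q y = difference_quotient g x y.
  apply: (@filterE _ (nbhs x)) => y /eqP yx; rewrite /= in_itv /= => yA.
  have yxn0 : y - x != 0 by by rewrite subr_eq0; exact/eqP.
  apply: (mulIf yxn0); rewrite /difference_quotient divfK // !gE //.
  rewrite -mulrBr subrXX /q.
  have -> : \sum_(i < m) (4 - y) ^+ (m.-1 - i) * (4 - x) ^+ i =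
            \sum_(i < m) (4 - y) ^+ (m - i.+1) * (4 - x) ^+ i.
    by apply: eq_bigr => i _; congr (_ ^+ _ * _); lia.
  by ring.
have FF := within_dnbhs_proper xA.
apply: (cvg_trans (@near_eq_cvg _ _ _ (@filter_filter _ _ FF) _ _ qE)).
have -> : - (c * m%:R * (4 - x) ^+ m.-1) = q x.
  rewrite /q -mulrA; congr (- (c * _)).
  rewrite (eq_bigr (fun=> (4 - x) ^+ m.-1)); last first.
    by move=> i _; rewrite -exprD; congr (_ ^+ _); case: i => i /=; lia.
  by rewrite sumr_const card_ord mulr_natl.
have qc : {for x, continuous q}.
  apply: cvgN; apply: cvgMl_tmp; apply: cvg_finsum => i _.
  apply: cvgMr_tmp.
  have h : 4 - y @[y --> x] --> 4 - x.
    by apply: cvgB; [exact: cvg_cst|exact: cvg_id].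
  exact: (cvg_comp _ _ h (@exprn_continuous R (m.-1 - i) (4 - x))).
move=> B /qc qB.
exact: (@filterS _ (nbhs x) _ (q @^-1` B) _ (fun y yB _ _ => yB) qB).
Qed.

Lemma derive_within_n_power (c : R) (m k : nat) (x : R) : 0 < x <= 4 ->
  derive_within_n `]0, 4] k (fun r => c * (4 - r) ^+ m) x =
    (-1) ^+ k * (c * (m ^_ k)%:R) * (4 - x) ^+ (m - k).
Proof.
elim: k x => [|k IH] x xA; first by rewrite /= ffactn0 subn0 expr0; ring.
rewrite /derive_within_n iterS -/(derive_within_n _ _ _) /derive_within.
have /= h := difference_quotient_cvg xA IH.
have P := within_dnbhs_proper xA.
rewrite (cvg_lim _ h) // ffactnSr natrM -subnS exprS subnS; ring.
Qed.

Lemma completely_monotonic_power (c : R) (m : nat) : 0 <= c ->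
  completely_monotonic (fun r : R => c * (4 - r) ^+ m).
Proof.
move=> c0; split.
  move=> k x; rewrite /= in_itv /= => xA.
  apply/cvg_ex; eexists; apply: difference_quotient_cvg => //.
  by move=> y; exact: derive_within_n_power.
move=> k x xA; rewrite derive_within_n_power // !mulrA -expr2 sqrr_sign mul1r.
by rewrite !mulr_ge0 ?ler0n // exprn_ge0 //; case/andP: xA => *; lra.
Qed.

End PowerPotentials.

(** * Inner products and contacts *)

Section InnerProduct.
Variable R : realType.

Definition dot (L : finType) (u v : L -> R) : R := \sum_l u l * v l.
Definition contacts (T L : finType) (x : T -> L -> R) : nat :=
  \sum_i \sum_(j | j != i) (dot (x i) (x j) == 0%R)%N.

Lemma dotC (L : finType) (u v : L -> R) : dot u v = dot v u.
Proof. by apply: eq_bigr => l _; rewrite mulrC. Qed.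

Lemma dot_geN1 (L : finType) (u v : L -> R) :
  dot u u = 1 -> dot v v = 1 -> - 1 <= dot u v.
Proof.
move=> u1 v1.
have : 0 <= \sum_l (u l + v l) ^+ 2 by apply: sumr_ge0 => l _; rewrite sqr_ge0.
have -> : \sum_l (u l + v l) ^+ 2 = dot u u + dot v v + 2 * dot u v.
  rewrite /dot mulr_sumr -!big_split /=; apply: eq_bigr => l _; ring.
rewrite u1 v1; lra.
Qed.

Lemma big_option (V : Type) (idx : V) (op : Monoid.com_law idx) (T : finType)
    (P : pred (option T)) (F : option T -> V) :
  \big[op/idx]_(i | P i) F i =
  op (if P None then F None else idx)
     (\big[op/idx]_(i | P (Some i)) F (Some i)).
Proof.
rewrite big_mkcond (bigD1 None) //=; congr (op _ _).
rewrite (reindex_omap Some id) /=; last by case.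
by rewrite [RHS]big_mkcond; apply: eq_bigl => i; rewrite eqxx.
Qed.

Lemma dot_option (L : finType) (u v : option L -> R) :
  dot u v = u None * v None + dot (fun l => u (Some l)) (fun l => v (Some l)).
Proof. by rewrite /dot big_option. Qed.

End InnerProduct.

(** * The energy of power potentials *)

Section PowerEnergy.
Local Open Scope classical_set_scope.
Variable R : realType.

Definition power_energy (T L : finType) (x : T -> L -> R) (k : nat) : R :=
  \sum_i \sum_(j | j != i) (1 + dot (x i) (x j)) ^+ k.

Lemma enorm_sqr (n : nat) (x : 'rV[R]_n) : enorm x ^+ 2 = dot (x ord0) (x ord0).
Proof.
rewrite /enorm sqr_sqrtr; first by apply: eq_bigr => i _; rewrite expr2.
by apply: sumr_ge0 => i _; rewrite sqr_ge0.
Qed.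

Lemma sphereP (n : nat) (x : 'rV[R]_n) : sphere x <-> dot (x ord0) (x ord0) = 1.
Proof.
rewrite -enorm_sqr /sphere /=; split => [->|]; first by rewrite expr1n.
by move/eqP; rewrite sqrp_eq1 ?sqrtr_ge0 // => /eqP.
Qed.

Lemma enormB_sqr (n : nat) (x y : 'rV[R]_n) : sphere x -> sphere y ->
  enorm (x - y) ^+ 2 = 2 - 2 * dot (x ord0) (y ord0).
Proof.
move=> /sphereP hx /sphereP hy; rewrite enorm_sqr.
transitivity (dot (x ord0) (x ord0) + dot (y ord0) (y ord0)
              - 2 * dot (x ord0) (y ord0)); last by rewrite hx hy; ring.
rewrite /dot mulr_sumr -big_split -sumrB.
by apply: eq_bigr => i _; rewrite !mxE /=; ring.
Qed.

(** For unit vectors, (4 - |x - y|^2) / 2 = 1 + <x, y>. *)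
Lemma potential_energy_family (n : nat) (T : finType) (x : T -> 'rV[R]_n)
    (C : {fset 'rV[R]_n}) (k : nat) :
  injective x -> (forall i, sphere (x i)) -> perm_eq C (codom x) ->
  potential_energy (fun r => 2^-1 ^+ k * (4 - r) ^+ k) C =
    power_energy (fun i => x i ord0) k.
Proof.
move=> xI x1 Cx; rewrite /potential_energy (perm_big _ Cx) /codom big_image /=.
apply: eq_bigr => i _; rewrite (perm_big _ Cx) big_image_cond /=.
apply: eq_big => [j|j _]; first by rewrite (inj_eq xI) eq_sym.
by rewrite enormB_sqr // -exprMn; congr (_ ^+ k); field.
Qed.

(** Universal optimality is used only through this consequence, in which
    configurations are families of distinct unit vectors indexed by any finite
    type of the right cardinality. *)
Lemma universally_optimal_power (n : nat) (C : {fset 'rV[R]_n}) :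
  universally_optimal C ->
  exists x : 'I_#|` C|%fset -> 'I_n -> R, (forall i, dot (x i) (x i) = 1) /\
    forall (T : finType) (y : T -> 'I_n -> R), #|T| = #|` C|%fset ->
      (forall i, dot (y i) (y i) = 1) ->
      (forall i j, j != i -> dot (y i) (y j) < 1) ->
      forall k, power_energy x k <= power_energy y k.
Proof.
move=> [C1 Copt]; pose x (i : 'I_#|` C|%fset) := nth 0 C i.
have xI : injective x.
  move=> i j /eqP; rewrite nth_uniq ?fset_uniq ?ltn_ord // => /eqP.
  exact: val_inj.
have xC : codom x = C.
  rewrite codomE /x -[RHS](mkseq_nth 0) /mkseq -val_enum_ord -map_comp.
  exact: eq_map.
have x1 i : sphere (x i) by apply: C1; rewrite /= mem_nth.
exists (fun i => x i ord0); split; first by move=> i; apply/sphereP.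
move=> T y cT y1 ylt k; pose y' i : 'rV[R]_n := \row_l y i l.
have dotE i j : dot (y' i ord0) (y' j ord0) = dot (y i) (y j).
  by apply: eq_bigr => l _; rewrite !mxE.
have y'1 i : sphere (y' i) by apply/sphereP; rewrite dotE.
have yI : injective y'.
  move=> i j yij; apply/eqP/negPn/negP => ij.
  by have := ylt _ _ ij; rewrite -dotE yij dotE y1 ltxx.
have C'y : perm_eq (seq_fset tt (codom y')) (codom y').
  apply: perm_trans (seq_fset_perm _ _) _.
  by rewrite undup_id // map_inj_uniq // enum_uniq.
have -> : power_energy y k = power_energy (fun i => y' i ord0) k.
  by apply: eq_bigr => i _; apply: eq_bigr => j _; rewrite dotE.
rewrite -(potential_energy_family _ yI y'1 C'y).
rewrite -(@potential_energy_family _ _ _ C _ xI x1); last by rewrite xC.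
apply: Copt.
- by apply: completely_monotonic_power; rewrite exprn_ge0.
- move=> z zC.
  by have /codomP[i ->] : z \in codom y' by rewrite -(seq_fsetE tt).
- by rewrite (perm_size C'y) size_codom.
Qed.

End PowerEnergy.

(** * Vectors with nonpositive inner products have many contacts *)

Section LowerBound.
Variable R : realType.

Section Obtuse.
Variables (N : nat) (L : finType) (x : 'I_N -> L -> R).
Hypothesis x1 : forall i, dot (x i) (x i) = 1.
Hypothesis xle0 : forall i j, j != i -> dot (x i) (x j) <= 0.

Lemma dot_sum (v : 'I_N -> R) (u : L -> R) :
  dot (fun l => \sum_i v i * x i l) u = \sum_i v i * dot (x i) u.
Proof.
rewrite /dot; under eq_bigr => l _ do rewrite mulr_suml.
rewrite exchange_big; apply: eq_bigr => i _; rewrite mulr_sumr.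
by apply: eq_bigr => l _; rewrite mulrA.
Qed.

(** Replacing v by its absolute values keeps the diagonal terms of the Gram form
    and does not increase the other ones, whose coefficients are nonpositive;
    so the squared norm of the combination stays 0. *)
Lemma abs_dependency (v : 'I_N -> R) :
  (forall l, \sum_i v i * x i l = 0) -> forall l, \sum_i `|v i| * x i l = 0.
Proof.
move=> v0.
pose s (w : 'I_N -> R) l := \sum_i w i * x i l.
have sE w : dot (s w) (s w) = \sum_i \sum_j w i * w j * dot (x i) (x j).
  rewrite dot_sum; apply: eq_bigr => i _; rewrite dotC dot_sum mulr_sumr.
  by apply: eq_bigr => j _; rewrite dotC; ring.
have : dot (s (fun i => `|v i|)) (s (fun i => `|v i|)) <= 0.
  have -> : 0 = dot (s v) (s v).
    by rewrite /dot big1 // => l _; rewrite /s v0 mul0r.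
  rewrite !sE; apply: ler_sum => i _; apply: ler_sum => j _.
  have [->|ji] := eqVneq j i; first by rewrite -expr2 real_normK ?num_real.
  by apply: ler_wnM2r; [exact: xle0|rewrite -normrM ler_norm].
move=> le0.
have ge0 l : true -> 0 <= s (fun i => `|v i|) l * s (fun i => `|v i|) l.
  by move=> _; rewrite -expr2 sqr_ge0.
have /eqP := le_anti (introT andP (conj le0 (sumr_ge0 _ ge0))).
rewrite psumr_eq0 // => /allP h l.
by have /eqP/eqP := h l (mem_index_enum l); rewrite mulf_eq0 orbb => /eqP.
Qed.

Let e : rel 'I_N := fun i j => dot (x i) (x j) != 0.
Let e_sym : connect_sym e.
Proof. by apply: sym_connect_sym => i j; rewrite /e dotC. Qed.

Let root := @fingraph.root _ e.
(* The connected component of r, and the representatives of the components with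
   at least two points. *)
Let block r := [set j | connect e r j].
Let bigroots := [set r | (root r == r) && (1 < #|block r|)%N].

(** The zero set of a dependency is a union of components, and a dependency
    vanishes at every isolated point, since the vector there is orthogonal to
    all the others. *)
Lemma dependency_vanishing (v : 'I_N -> R) :
  (forall l, \sum_i v i * x i l = 0) ->
  (forall r, r \in bigroots -> v r = 0) -> forall i, v i = 0.
Proof.
move=> v0 vr; have a0 := abs_dependency v0.
have d0 j : \sum_i `|v i| * dot (x i) (x j) = 0.
  by rewrite -dot_sum /dot big1 // => l _; rewrite a0 mul0r.
have vanish_edge i j : e j i -> v j = 0 -> v i = 0.
  move=> eji vj; have [->//|ij] := eqVneq i j.
  have t0 k : true -> 0 <= - (`|v k| * dot (x k) (x j)).
    move=> _; have [->|kj] := eqVneq k j.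
      by rewrite vj normr0 mul0r oppr0.
    by rewrite -mulrN mulr_ge0 // oppr_ge0 dotC xle0.
  have /eqP := d0 j; rewrite -oppr_eq0 -sumrN psumr_eq0 // => /allP h.
  have /eqP/eqP := h i (mem_index_enum i).
  by rewrite oppr_eq0 mulf_eq0 dotC (negbTE eji) orbF normr_eq0 => /eqP.
have vanish_connect i j : connect e j i -> v j = 0 -> v i = 0.
  move=> /connectP[p]; elim: p j => [|k p IH] j /= ; first by move=> _ ->.
  by case/andP=> ejk pk il vj; apply: (IH k) => //; exact: vanish_edge ejk vj.
move=> i; apply: (vanish_connect i (root i)).
  by rewrite e_sym connect_root.
set r := root i; have rr : root r = r by rewrite /root root_root.
have [b|b] := ltnP 1 #|block r|; first by apply: vr; rewrite inE rr eqxx b.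
have br : block r = [set r].
  apply/eqP; rewrite eq_sym eqEcard cards1 b andbT finset.sub1set.
  by rewrite inE connect0.
have := d0 r; rewrite (bigD1 r) //= x1 mulr1 big1 ?addr0.
  by move/eqP; rewrite normr_eq0 => /eqP.
move=> k kr; apply/eqP; rewrite mulf_eq0; apply/orP; right.
apply: contraNT kr => h.
have : k \in block r by rewrite inE connect1 // /e dotC.
by rewrite br inE.
Qed.

(** Evaluation at the representatives embeds the space of linear dependencies,
    whose dimension is at least N - #|L|. *)
Lemma corank_le_blocks : (N - #|L| <= #|bigroots|)%N.
Proof.
pose X := \matrix_(i < N, l < #|L|) x i (enum_val l).
pose D := \matrix_(i < N, r < #|bigroots|) ((i == enum_val r)%:R : R).
have K0 : (kermx X :&: kermx D = 0)%MS.
  apply/eqP/rowV0P => v.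
  rewrite sub_capmx => /andP[/sub_kermxP vX /sub_kermxP vD].
  apply/rowP => i; rewrite mxE.
  apply: (@dependency_vanishing (fun i => v 0 i)) i.
    move=> l; have := congr1 (fun A : 'rV_#|L| => A 0 (enum_rank l)) vX.
    by rewrite !mxE; under eq_bigr do rewrite mxE enum_rankK.
  move=> r rB.
  have := congr1 (fun A : 'rV_#|bigroots| => A 0 (enum_rank_in rB r)) vD.
  rewrite !mxE (bigD1 r) //= mxE enum_rankK_in // eqxx mulr1 big1 ?addr0 //.
  by move=> k kr; rewrite mxE enum_rankK_in // (negbTE kr) mulr0.
have := mxrank_mul_ker (kermx X) D; rewrite K0 mxrank0 addn0 mxrank_ker.
have := rank_leq_col (kermx X *m D); have := rank_leq_col X; lia.
Qed.

(** Non-orthogonal pairs lie inside components, so there are at most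
    [\sum_r s_r * (s_r - 1)] of them for component sizes s_r. Given the number
    of components with at least two points, this sum is largest when all of
    these but one have exactly two points. *)
Lemma contacts_ge (p d : nat) : (N = 2 * p + d + 2)%N -> (#|L| = p + d + 1)%N ->
  (N * (N - 1) <= contacts x + 2 * p + (d + 2) * (d + 1))%N.
Proof.
move=> Np Lp; have := corank_le_blocks.
(* The size of the component represented by r; 0 if r represents none. *)
pose s (r : 'I_N) := if root r == r then #|block r| else 0%N.
have rootE i j : (root i == root j) = connect e i j by rewrite root_connect.
have cE i : (N - 1 <= \sum_(j | j != i) (dot (x i) (x j) == 0%R) +
                      (#|block i| - 1))%N.
  have -> : (N - 1 = \sum_(j | j != i) 1)%N.
    by rewrite sum1_card cardC1 card_ord subn1.
  have -> : (#|block i| - 1 = \sum_(j | j != i) (j \in block i))%N.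
    have ii : i \in block i by rewrite inE connect0.
    have -> : #|block i| = (\sum_j (j \in block i))%N.
      by rewrite -big_mkcond sum1_card.
    by rewrite (bigD1 i) //= ii add1n subSS subn0.
  rewrite -big_split; apply: leq_sum => j ji /=.
  case: (boolP (dot (x i) (x j) == 0)) => // h.
  by rewrite inE connect1.
have c1 : (N * (N - 1) <= contacts x + \sum_i (#|block i| - 1))%N.
  rewrite /contacts -big_split /= -[X in (X * _)%N]card_ord -sum_nat_const.
  exact: leq_sum.
have blk i : #|block (root i)| = #|block i|.
  apply: eq_card => j; rewrite !inE; apply: (same_connect e_sym).
  by rewrite e_sym connect_root.
have sumF (F : nat -> nat) : (\sum_i F #|block i| = \sum_r s r * F (s r))%N.
  rewrite (partition_big (root) (fun r => root r == r)) /=; last first.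
    by move=> i _; rewrite /root root_root.
  rewrite [RHS](bigID (fun r => root r == r)) /= [X in (_ + X)%N]big1 ?addn0.
    apply: eq_bigr => r /eqP rr; rewrite /s rr eqxx.
    rewrite (eq_bigr (fun=> F #|block r|)); last by move=> i /eqP <-; rewrite blk.
    rewrite sum_nat_const; congr (_ * _)%N.
    by apply: eq_card => i; rewrite !inE -rootE [RHS]eq_sym [in RHS]rr.
  by move=> r /negbTE; rewrite /s => ->.
have sN : (\sum_r s r = N)%N.
  transitivity (\sum_(i < N) 1)%N; last by rewrite sum1_card card_ord.
  rewrite (sumF (fun=> 1%N)).
  by apply: eq_bigr => r _; rewrite muln1.
have bE : bigroots = [set r | 1 < s r]%N.
  by apply/setP => r; rewrite !inE /s; case: eqP.
rewrite bE => kle.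
(* In terms of the excess a = s - 2, a component has s (s - 1) = 2 + 3a + a^2
   ordered pairs, and the sum of the squares of the excesses is at most the
   square of their sum. *)
pose a r := (s r - 2)%N.
have t1 : (\sum_i (#|block i| - 1) =
  \sum_(r in [set r | 1 < s r]) (2 + 3 * a r + a r * a r))%N.
  rewrite (sumF (fun m => m - 1)%N) (bigID (mem [set r | 1 < s r]%N)) /=.
  rewrite [X in (_ + X)%N]big1 ?addn0.
    by apply: eq_bigr => r; rewrite inE /a; nia.
  by move=> r; rewrite inE; nia.
have t2 : (\sum_(r in [set r | 1 < s r]) (2 + a r) <= \sum_r s r)%N.
  rewrite [X in (_ <= X)%N](bigID (mem [set r | 1 < s r]%N)) /=.
  apply: leq_trans (leq_addr _ _); apply: leq_sum => r; rewrite inE /a; lia.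
have t3 : (\sum_(r in [set r | 1 < s r]) a r * a r <=
  (\sum_(r in [set r | 1 < s r]) a r) * (\sum_(r in [set r | 1 < s r]) a r))%N.
  rewrite big_distrl /=; apply: leq_sum => r rB; rewrite leq_mul2l.
  by rewrite (bigD1 r) //= leq_addr orbT.
rewrite sN in t2.
rewrite !big_split /= !sum_nat_const -?big_distrr /= in t1 t2.
move: t3 t1 t2 kle c1.
set Q := (\sum_(r in _) (a r * a r))%N; set A := (\sum_(r in _) a r)%N.
set q := #|_|; move=> t3 t1 t2 kle c1.
have Ad : (A <= d)%N by lia.
have : (A * A <= d * d)%N by exact: leq_mul.
rewrite {}t1 muln0 !addn0 in c1 => AA; move: c1.
set K := (N * (N - 1))%N; rewrite mulnDl !mulnDr; lia.
Qed.

End Obtuse.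

End LowerBound.

(** * Limits of powers *)

Section Asymptotics.
Local Open Scope classical_set_scope.
Variable R : realType.

Lemma bernoulli_ineq (t : R) (m : nat) :
  -1 <= t -> 1 + m%:R * t <= (1 + t) ^+ m.
Proof.
move=> t1; elim: m => [|m IH]; first by rewrite mul0r addr0 expr0.
rewrite exprS; apply: le_trans (ler_wpM2l _ IH); last by lra.
have : 0 <= m%:R * t ^+ 2 by rewrite mulr_ge0 ?ler0n ?sqr_ge0.
rewrite mulrS expr2 => h; lra.
Qed.

(** With J = j + 2, the depth is s = J^-2 and will go with the exponent k = J^3,
    so that s k = J tends to infinity and s^2 k = J^-1 tends to 0. *)
Definition depth (j : nat) : R := (j.+2%:R ^+ 2)^-1.

Let natS2_neq0 (j : nat) : j.+2%:R != 0 :> R.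
Proof. by rewrite pnatr_eq0. Qed.

Lemma depth_gt0 j : 0 < depth j.
Proof. by rewrite invr_gt0 exprn_gt0 ?ltr0n. Qed.

Lemma depth_lt1 j : depth j < 1.
Proof. by rewrite invf_lt1 ?exprn_gt0 ?ltr0n // exprn_egt1 // ltr1n. Qed.

Lemma depth_cvg : depth j @[j --> \oo] --> 0.
Proof.
apply: (@squeeze_cvgr _ _ _ _ (fun=> 0) (@harmonic R)).
- apply: nearW => j; rewrite ltW ?depth_gt0 //= /harmonic.
  rewrite lef_pV2 ?posrE ?exprn_gt0 ?ltr0n //.
  by rewrite -natrX ler_nat; lia.
- exact: cvg_cst.
- exact: cvg_harmonic.
Qed.

(** From (1 - s)^k (1 + s)^k <= 1 and Bernoulli's inequality,
    (1 - s)^k <= (1 + k s)^-1 = (1 + J)^-1. *)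
Lemma cvg_pow_below : (1 - depth j) ^+ (j.+2 ^ 3) @[j --> \oo] --> 0.
Proof.
apply: (@squeeze_cvgr _ _ _ _ (fun=> 0) (@harmonic R)).
- apply: nearW => j; have d0 := depth_gt0 j; have d1 := depth_lt1 j.
  apply/andP; split; first by apply: exprn_ge0; lra.
  rewrite /harmonic /= -[j.+1%:R^-1]mul1r ler_pdivlMr ?ltr0n //.
  apply: (@le_trans _ _
    ((1 - depth j) ^+ (j.+2 ^ 3) * (1 + depth j) ^+ (j.+2 ^ 3))).
    apply: ler_wpM2l; first by apply: exprn_ge0; lra.
    apply: le_trans (bernoulli_ineq _ _); last by lra.
    have -> : (j.+2 ^ 3)%:R * depth j = j.+2%:R.
      rewrite /depth natrX; have := natS2_neq0 j.
      by set a := _%:R => a0; field.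
    by rewrite -[j.+1%:R]add0r lerD // ler_nat.
  rewrite -exprMn; apply: exprn_ile1; nra.
- exact: cvg_cst.
- exact: cvg_harmonic.
Qed.

(** From (1 + s^2)^k (1 - s^2)^k <= 1 and Bernoulli's inequality,
    (1 + s^2)^k <= (1 - k s^2)^-1 = (1 - J^-1)^-1. *)
Lemma cvg_pow_above : (1 + depth j ^+ 2) ^+ (j.+2 ^ 3) @[j --> \oo] --> (1 : R).
Proof.
apply: (@squeeze_cvgr _ _ _ _ (fun=> 1 : R)
  (fun j : nat => 1 + @harmonic R j : R)).
- apply: nearW => j; have d0 := depth_gt0 j; have d1 := depth_lt1 j.
  have q0 : 0 <= depth j ^+ 2 <= 1 by rewrite sqr_ge0 expr_le1 ?ltW.
  case/andP: q0 => q0 q1.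
  apply/andP; split; first by apply: exprn_ege1; lra.
  have e0 : (j.+2 ^ 3)%:R * depth j ^+ 2 = j.+2%:R^-1.
    rewrite /depth natrX; have := natS2_neq0 j.
    by set a := _%:R => a0; field.
  have e1 : 1 + @harmonic R j = (1 - j.+2%:R^-1)^-1.
    rewrite /harmonic /= -[j.+2%:R]natr1; field.
    by apply/andP; split; rewrite ?pnatr_eq0 // addrK pnatr_eq0.
  rewrite e1 -[(1 - j.+2%:R^-1)^-1]mul1r ler_pdivlMr; last first.
    by rewrite subr_gt0 invf_lt1 ?ltr0n // ltr1n.
  apply: (@le_trans _ _
    ((1 + depth j ^+ 2) ^+ (j.+2 ^ 3) * (1 - depth j ^+ 2) ^+ (j.+2 ^ 3))).
    apply: ler_wpM2l; first by apply: exprn_ge0; lra.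
    by rewrite -e0 -mulrN; apply: bernoulli_ineq; lra.
  rewrite -exprMn; apply: exprn_ile1; nra.
- exact: cvg_cst.
- rewrite -[X in _ --> X]addr0.
  by apply: cvgD; [exact: cvg_cst|exact: cvg_harmonic].
Qed.

End Asymptotics.

(** * Lowering a base below an apex *)

Section Comparison.
Local Open Scope classical_set_scope.
Variable R : realType.

Section Lowering.
Variables (T L : finType) (b : T -> L -> R).
Hypothesis b1 : forall i, dot (b i) (b i) = 1.
Hypothesis ble0 : forall i j, j != i -> dot (b i) (b j) <= 0.

(** The coordinate [None] is the direction of the apex, and the index [None] is
    the apex itself; the base, scaled to keep unit length, lies at height -s. *)
Definition lowered (s : R) (i : option T) (l : option L) : R :=
  match i, l with
  | None, None => 1
  | None, Some _ => 0
  | Some _, None => - s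
  | Some i, Some l => Num.sqrt (1 - s ^+ 2) * b i l
  end.

Lemma dot_lowered_apex (s : R) (i : T) :
  dot (lowered s None) (lowered s (Some i)) = - s.
Proof.
by rewrite dot_option /= mul1r {1}/dot big1 ?addr0 // => l _; rewrite mul0r.
Qed.

Lemma dot_lowered_base (s : R) (i j : T) : 0 <= s <= 1 ->
  dot (lowered s (Some i)) (lowered s (Some j)) =
    dot (b i) (b j) + s ^+ 2 * (1 - dot (b i) (b j)).
Proof.
move=> s01; rewrite dot_option /=.
have -> : dot (fun l => Num.sqrt (1 - s ^+ 2) * b i l)
              (fun l => Num.sqrt (1 - s ^+ 2) * b j l) =
          (Num.sqrt (1 - s ^+ 2)) ^+ 2 * dot (b i) (b j).
  by rewrite /dot mulr_sumr; apply: eq_bigr => l _; ring.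
rewrite sqr_sqrtr; first by ring.
by rewrite subr_ge0 expr_le1 //; case/andP: s01.
Qed.

Lemma lowered_unit (s : R) (i : option T) : 0 <= s <= 1 ->
  dot (lowered s i) (lowered s i) = 1.
Proof.
case: i => [i|] s01; first by rewrite dot_lowered_base // b1; ring.
by rewrite dot_option /= mul1r /dot big1 ?addr0 // => l _; rewrite mul0r.
Qed.

Lemma lowered_lt1 (s : R) (i j : option T) : 0 < s < 1 -> j != i ->
  dot (lowered s i) (lowered s j) < 1.
Proof.
move=> /andP[s0 s1]; have s01 : 0 <= s <= 1 by rewrite !ltW.
case: i j => [i|] [j|] //= ij.
- rewrite dot_lowered_base //.
  have d0 := ble0 ij.
  have : s ^+ 2 * (1 - dot (b i) (b j)) < 1 * (1 - dot (b i) (b j)).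
    by rewrite ltr_pM2r ?expr_lt1 ?ltW //; lra.
  lra.
- by rewrite dotC dot_lowered_apex; lra.
- by rewrite dot_lowered_apex; lra.
Qed.

(** A negative inner product t rises to at most t + 2 s^2, which is eventually
    below -s, so this case reduces to the one of the apex. *)
Lemma cvg_base_pair i j : j != i ->
  (1 + dot (lowered (depth R k) (Some i)) (lowered (depth R k) (Some j)))
      ^+ (k.+2 ^ 3)
    @[k --> \oo] --> ((dot (b i) (b j) == 0)%R%:R : R).
Proof.
move=> ij; have t0 := ble0 ij; have t1 := dot_geN1 (b1 i) (b1 j).
have s01 k : 0 <= depth R k <= 1 by rewrite !ltW ?depth_gt0 ?depth_lt1.
have [t00|tn0] := eqVneq (dot (b i) (b j)) 0.
  under eq_cvg do rewrite dot_lowered_base // t00 subr0 mulr1 add0r.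
  exact: cvg_pow_above.
apply: (@squeeze_cvgr _ _ _ _ (fun=> 0) (fun k => (1 - depth R k) ^+ (k.+2 ^ 3))).
- have tlt : 0 < - dot (b i) (b j) / 3.
    by rewrite divr_gt0 // oppr_gt0 lt_neqAle tn0.
  apply: (@filterS _ \oo _ _ _ _ (cvgr_lt _ (@depth_cvg R) _ tlt)) => k /= dk.
  have d0 := depth_gt0 R k; have d1 := depth_lt1 R k.
  rewrite dot_lowered_base //.
  apply/andP; split; first by apply: exprn_ge0; nra.
  by apply: lerXn2r; rewrite ?nnegrE; nra.
- exact: cvg_cst.
- exact: cvg_pow_below.
Qed.

Lemma lowered_energy_cvg :
  power_energy (lowered (depth R k)) (k.+2 ^ 3) @[k --> \oo] -->
    ((contacts b)%:R : R).
Proof.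
pose l (i j : option T) : R :=
  if (i, j) is (Some i, Some j) then (dot (b i) (b j) == 0)%R%:R else 0.
have -> : (contacts b)%:R = \sum_i \sum_(j | j != i) l i j.
  rewrite big_option /= big1 ?add0r; last by case.
  rewrite /contacts natr_sum; apply: eq_bigr => i _.
  by rewrite big_option /= add0r natr_sum.
apply: cvg_finsum => i _; apply: cvg_finsum => j ij.
case: i j ij => [i|] [j|] //= ij; first exact: cvg_base_pair.
- by under eq_cvg do rewrite dotC dot_lowered_apex; exact: cvg_pow_below.
- by under eq_cvg do rewrite dot_lowered_apex; exact: cvg_pow_below.
Qed.

(** The energy of the lowered configurations stays bounded, which excludes
    positive inner products t in x, as (1 + t)^k would be unbounded; and each
    contact of x contributes 1 to its energy. *)
Lemma optimal_contacts (U M : finType) (x : U -> M -> R) :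
  (forall i, dot (x i) (x i) = 1) ->
  (forall k, power_energy x (k.+2 ^ 3) <=
    power_energy (lowered (depth R k)) (k.+2 ^ 3)) ->
  (forall i j, j != i -> dot (x i) (x j) <= 0) /\ (contacts x <= contacts b)%N.
Proof.
move=> x1 xopt; set c := contacts b.
have cc : (c%:R : R) < c%:R + 2^-1 by lra.
have ev : \forall k \near \oo,
    power_energy (lowered (depth R k)) (k.+2 ^ 3) < c%:R + 2^-1.
  exact: (cvgr_lt _ lowered_energy_cvg _ cc).
have term_ge0 i j k : 0 <= (1 + dot (x i) (x j)) ^+ k.
  by apply: exprn_ge0; have := dot_geN1 (x1 i) (x1 j); lra.
split.
  move=> i j ij; rewrite leNgt; apply/negP => t0.
  have ev2 := nbhs_infty_ger ((c%:R + 2^-1) / dot (x i) (x j)).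
  have [k [kE kJ]] := filter_ex (filterI ev ev2).
  have : (1 + dot (x i) (x j)) ^+ (k.+2 ^ 3) <= power_energy x (k.+2 ^ 3).
    rewrite /power_energy (bigD1 i) //= (bigD1 j) //= -addrA lerDl.
    rewrite addr_ge0 //; first by apply: sumr_ge0.
    by apply: sumr_ge0 => ? _; apply: sumr_ge0.
  apply/negP; rewrite -ltNge; apply: le_lt_trans (xopt k) _.
  apply: lt_le_trans kE _; apply: le_trans (bernoulli_ineq _ _); last by lra.
  move: kJ; rewrite ler_pdivrMr // => kJ.
  apply: le_trans kJ _.
  apply: (@le_trans _ _ ((k.+2 ^ 3)%:R * dot (x i) (x j))); last by lra.
  by rewrite ler_pM2r // ler_nat; nia.
have [k kE] := filter_ex ev.
have : (contacts x)%:R <= power_energy x (k.+2 ^ 3).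
  rewrite /contacts natr_sum; apply: ler_sum => i _; rewrite natr_sum.
  apply: ler_sum => j _; case: eqP => [->|_]; last exact: term_ge0.
  by rewrite addr0 expr1n.
move=> /le_trans/(_ (xopt k))/le_lt_trans/(_ kE) h.
rewrite -ltnS -(ltr_nat R); apply: lt_trans h _; rewrite -[c.+1%:R]natr1; lra.
Qed.

End Lowering.

End Comparison.

(** * A base with few contacts *)

Section ExplicitBase.
Variable R : realType.

Lemma exists_unit_rescaling (T L : finType) (w : T -> L -> R) :
  (forall i, 0 < dot (w i) (w i)) ->
  (forall i j, j != i -> dot (w i) (w j) <= 0) ->
  exists b : T -> L -> R, [/\ forall i, dot (b i) (b i) = 1,
    forall i j, j != i -> dot (b i) (b j) <= 0 & contacts b = contacts w].
Proof.
move=> w_gt0 w_le0; pose r i := (Num.sqrt (dot (w i) (w i)))^-1.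
have r_gt0 i : 0 < r i by rewrite invr_gt0 sqrtr_gt0.
pose b i l := r i * w i l.
have bE i j : dot (b i) (b j) = r i * r j * dot (w i) (w j).
  by rewrite /dot mulr_sumr; apply: eq_bigr => l _; rewrite /b; ring.
exists b; split=> [i|i j ij|].
- rewrite bE -expr2 /r exprVn sqr_sqrtr ?(ltW (w_gt0 i)) //.
  by rewrite mulVf // gt_eqF.
- by rewrite bE pmulr_rle0 ?mulr_gt0 // w_le0.
- apply: eq_bigr => i _; apply: eq_bigr => j _; rewrite bE.
  by rewrite mulf_eq0 gt_eqF ?mulr_gt0.
Qed.

Section Base.
Variables p d : nat.
Hypothesis d_gt0 : (0 < d)%N.

Definition base_index := (('I_p * bool) + option 'I_d)%type.
(** The vectors [inl (a, s)] are the antipodal pairs. The simplex consists of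
    e_c - (d + 1)^-1 (1, ..., 1) and -(1, ..., 1): any factor strictly between 0
    and 1/d in place of (d + 1)^-1 makes all its inner products negative. The
    vectors are not normalized. *)
Definition base (i : base_index) (l : 'I_p + 'I_d) : R :=
  match i, l with
  | inl (a, s), inl a' => (-1) ^+ s * (a == a')%:R
  | inr (Some c), inr c' => (c == c')%:R - d.+1%:R^-1
  | inr None, inr _ => -1
  | _, _ => 0
  end.

Lemma dot_sum_type (u v : 'I_p + 'I_d -> R) :
  dot u v = \sum_a u (inl a) * v (inl a) + \sum_c u (inr c) * v (inr c).
Proof. by rewrite /dot big_sumType. Qed.

Lemma sum_delta (m : nat) (i : 'I_m) (f : 'I_m -> R) :
  \sum_j (i == j)%:R * f j = f i.
Proof.
rewrite (bigD1 i) //= eqxx mul1r big1 ?addr0 // => j ji.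
by rewrite eq_sym (negbTE ji) mul0r.
Qed.

Lemma dot_pair a s a' s' :
  dot (base (inl (a, s))) (base (inl (a', s'))) =
    (-1) ^+ s * (-1) ^+ s' * (a == a')%:R.
Proof.
rewrite dot_sum_type /= [X in _ + X]big1 ?addr0; last by move=> *; rewrite mul0r.
rewrite (eq_bigr (fun c => (a == c)%:R * ((-1) ^+ s * (-1) ^+ s' * (c == a')%:R))).
  by rewrite sum_delta.
by move=> c _; rewrite [a' == c]eq_sym; ring.
Qed.

Lemma dot_pair_simplex a s o : dot (base (inl (a, s))) (base (inr o)) = 0.
Proof.
rewrite dot_sum_type /= !big1 ?addr0 // => *; first by rewrite mul0r.
by case: o => [?|] /=; rewrite mulr0.
Qed.

Lemma dot_simplex c c' :
  dot (base (inr (Some c))) (base (inr (Some c'))) =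
    (c == c')%:R - (d%:R + 2) / d.+1%:R ^+ 2.
Proof.
rewrite dot_sum_type /= [X in X + _]big1 ?add0r; last by move=> *; rewrite mul0r.
set e := d.+1%:R^-1.
rewrite (eq_bigr (fun k =>
  (c == k)%:R * ((k == c')%:R - e) - (c' == k)%:R * e + e ^+ 2)); last first.
  by move=> k _; rewrite [c' == k]eq_sym; ring.
rewrite big_split sumrB !sum_delta sumr_const card_ord -[e ^+ 2 *+ d]mulr_natl /e /=.
have := pnatr_eq0 R d.+1; rewrite -natr1 => /= /negbT; set D := d%:R => D0.
by field.
Qed.

Lemma dot_simplex_last c :
  dot (base (inr (Some c))) (base (inr None)) = - d.+1%:R^-1.
Proof.
rewrite dot_sum_type /= [X in X + _]big1 ?add0r; last by move=> *; rewrite mul0r.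
set e := d.+1%:R^-1.
rewrite (eq_bigr (fun k => (c == k)%:R * (-1) + e)); last by move=> k _; ring.
rewrite big_split sum_delta sumr_const card_ord -[e *+ d]mulr_natl /e /=.
have := pnatr_eq0 R d.+1; rewrite -natr1 => /= /negbT; set D := d%:R => D0.
by field.
Qed.

Lemma dot_last : dot (base (inr None)) (base (inr None)) = d%:R.
Proof.
rewrite dot_sum_type /= [X in X + _]big1 ?add0r; last by move=> *; rewrite mul0r.
by rewrite sumr_const card_ord mulrNN mulr1.
Qed.

Let d1 : (1 : R) <= d%:R. Proof. by rewrite ler1n. Qed.

Lemma base_gt0 i : 0 < dot (base i) (base i).
Proof.
case: i => [[a s]|[c|]].
- by rewrite dot_pair eqxx mulr1 -expr2 sqrr_sign.
- rewrite dot_simplex eqxx subr_gt0 ltr_pdivrMr ?exprn_gt0 ?ltr0n //.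
  rewrite ?mul1r -[d.+1%:R]natr1; move: d1; set D := d%:R => D1.
  have : 0 <= (D - 1) ^+ 2 by rewrite sqr_ge0.
  by rewrite !expr2; nra.
- by rewrite dot_last ltr0n.
Qed.

Lemma simplex_lt0 o o' : o' != o -> dot (base (inr o)) (base (inr o')) < 0.
Proof.
case: o o' => [c|] [c'|] // oo.
- rewrite dot_simplex; have -> : (c == c') = false.
    by apply/negbTE; apply: contraNneq oo => ->.
  by rewrite sub0r oppr_lt0 divr_gt0 ?exprn_gt0 ?ltr0n // addr_gt0 ?ltr0n.
- by rewrite dot_simplex_last oppr_lt0 invr_gt0 ltr0n.
- by rewrite dotC dot_simplex_last oppr_lt0 invr_gt0 ltr0n.
Qed.

Lemma base_le0 i j : j != i -> dot (base i) (base j) <= 0.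
Proof.
case: i j => [[a s]|o] [[a' s']|o'] ij.
- rewrite dot_pair; have [aa|] := eqVneq a a'; last by rewrite mulr0.
  rewrite mulr1; move: ij; rewrite aa; case: s s' => [] [] /=;
    rewrite ?eqxx // ?expr0 ?expr1; lra.
- by rewrite dot_pair_simplex.
- by rewrite dotC dot_pair_simplex.
- by rewrite ltW // simplex_lt0.
Qed.

(** A member of an antipodal pair is not orthogonal to its antipode, and a
    vertex of the simplex is orthogonal only to the 2p members of the pairs. *)
Lemma contacts_base :
  (contacts base <= 2 * p * (2 * p + d - 1) + (d + 1) * (2 * p))%N.
Proof.
rewrite /contacts big_sumType /=; apply: leq_add.
  apply: (@leq_trans (\sum_(i : 'I_p * bool) (2 * p + d - 1))); last first.
    by rewrite sum_nat_const card_prod card_ord card_bool [(p * 2)%N]mulnC.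
  apply: leq_sum => -[a s] _.
  pose x : base_index := inl (a, s); pose y : base_index := inl (a, ~~ s).
  have xy : x != y by apply/eqP => -[]; case: s {x y}.
  apply: (@leq_trans (\sum_(j in ~: [set x; y]) 1)).
    rewrite big_mkcond [X in (_ <= X)%N]big_mkcond; apply: leq_sum => j _.
    rewrite !inE negb_or; case: eqVneq => //= jx.
    have [->|] := eqVneq j y => /=.
      by rewrite dot_pair eqxx mulr1 -signr_addb signr_eq0.
    by rewrite leq_b1.
  rewrite sum1_card cardsCs finset.setCK cards2 xy.
  rewrite card_sum card_prod card_option.
  by rewrite !card_ord card_bool; lia.
apply: (@leq_trans (\sum_(i : option 'I_d) (2 * p))); last first.
  by rewrite sum_nat_const card_option card_ord addn1.
apply: leq_sum => o _; rewrite big_sumType /= [X in (_ + X)%N]big1 ?addn0.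
  rewrite (@leq_trans (\sum_(i : 'I_p * bool) 1)) //.
    by apply: leq_sum => i _; rewrite leq_b1.
  by rewrite sum1_card card_prod card_ord card_bool mulnC.
move=> o' oo; rewrite lt_eqF // simplex_lt0 //.
Qed.
End Base.

Lemma dot_reindex (L L' : finType) (h : L' -> L) (u v : L -> R) : bijective h ->
  dot (u \o h) (v \o h) = dot u v.
Proof. by move=> hb; rewrite /dot [RHS](reindex h) //; exact: onW_bij. Qed.

End ExplicitBase.

(** * Nonexistence of universal optima *)

Theorem proposition1p4 (R : realType) (n N : nat) (hn : (0 < n)%N)
    (hN : (0 < N)%N) (hlo : (n + 1 < N)%N) (hhi : (N < 2 * n)%N) :
  ~ exists C : {fset 'rV[R]_n}, #|` C|%fset = N /\ universally_optimal C.
Proof.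
case=> C [CN /universally_optimal_power[x [x1 xopt]]].
pose p := (N - n - 1)%N; pose d := (2 * n - N)%N.
have d_gt0 : (0 < d)%N by rewrite /d; lia.
have [b [b1 b_le0 bc]] :=
  exists_unit_rescaling (base_gt0 R (p := p) d_gt0) (@base_le0 R p d).
have nL : n = #|{: option ('I_p + 'I_d)}|.
  by rewrite card_option card_sum !card_ord /p /d; lia.
(* The base lives in coordinates indexed by 'I_p + 'I_d, and the apex adds one
   more coordinate; h identifies these n coordinates with 'I_n. *)
pose h (l : 'I_n) : option ('I_p + 'I_d) := enum_val (cast_ord nL l).
have hb : bijective h.
  apply: bij_comp (enum_val_bij _) _.
  by exists (cast_ord (esym nL)); [exact: cast_ordK|exact: cast_ordKV].
have x_opt k : power_energy x (k.+2 ^ 3) <=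
    power_energy (lowered b (depth R k)) (k.+2 ^ 3).
  have d0 := depth_gt0 R k; have d1 := depth_lt1 R k.
  have -> : power_energy (lowered b (depth R k)) (k.+2 ^ 3) =
      power_energy (fun i => lowered b (depth R k) i \o h) (k.+2 ^ 3).
    by apply: eq_bigr => i _; apply: eq_bigr => j _; rewrite dot_reindex.
  apply: xopt => [|i|i j ij].
  - rewrite CN card_option card_sum card_prod card_option !card_ord card_bool.
    by rewrite /p /d; lia.
  - by rewrite dot_reindex // lowered_unit // !ltW.
  - by rewrite dot_reindex // lowered_lt1 // d0 d1.
have [x_le0 xc] := optimal_contacts b1 b_le0 x1 x_opt.
have N_eq : #|` C|%fset = (2 * p + d + 2)%N by rewrite CN /p /d; lia.
have n_eq : #|'I_n| = (p + d + 1)%N by rewrite card_ord /p /d; lia.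
have p_gt0 : (0 < p)%N by rewrite /p; lia.
have := @contacts_base R p d; rewrite -bc.
have := contacts_ge x1 x_le0 N_eq n_eq.
move: (contacts x) (contacts b) xc p_gt0 d_gt0 => X B xc.
rewrite N_eq.
(* The two bounds on the contacts differ by 4p. *)
case: (p) (d) => [//|q] [//|e] _ _ h1 h2.
have : (X <= 2 * q.+1 * (2 * q.+1 + e.+1 - 1) + (e.+1 + 1) * (2 * q.+1))%N.
  by lia.
nia.
Qed.
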